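(* Let $k\ge 2$ and $1\le i\le k$ be integers. Then, with the convention $N_k=0$, $$\sum_{m,n\ge 0}D_{k,i}(m,n)x^mq^n=\sum_{N_1\ge N_2\ge\cdots\ge N_{k-1}\ge 0}\frac{q^{\frac{(N_1+1)N_1}{2}+N_2^2+\cdots+N_{k-1}^2+N_{i+1}+\cdots+N_{k-1}}\,(-q)_{N_1-1}\,(1+q^{N_i})\,x^{N_1+\cdots+N_{k-1}}}{(q)_{N_1-N_2}\cdots(q)_{N_{k-2}-N_{k-1}}(q)_{N_{k-1}}}.$$
   Context: An overpartition of $n$ is a partition of $n$ in which the first occurrence of each part size may be overlined. Its parts $d_1,\ldots,d_s$ are written in non-increasing order of numerical value, an overlined part $\overline t$ being listed before all non-overlined copies of $t$. $D_{k,i}(m,n)$ is the number of overpartitions $d_1+\cdots+d_m$ of $n$ with exactly $m$ parts such that $1$ occurs as a non-overlined part at most $i-1$ times, and such that for every $j$ with $1\le j\le m-k+1$ one has $d_j-d_{j+k-1}\ge1$ if $d_j$ is overlined and $d_j-d_{j+k-1}\ge2$ otherwise (differences of underlying numerical values). The empty overpartition is counted by $D_{k,i}(0,0)=1$. Notation: $(a)_\infty=(a;q)_\infty=\prod_{j\ge0}(1-aq^j)$ and $(a)_n=(a;q)_n=(a)_\infty/(aq^n)_\infty$ for all integers $n$; so $(q)_n=\prod_{j=1}^n(1-q^j)$, $(-q)_n=\prod_{j=1}^n(1+q^j)$ for $n\ge 0$, and $(-q)_{-1}=1/2$. The sum $N_{i+1}+\cdots+N_{k-1}$ is $0$ when $i\ge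 k-1$. The denominator is $\big(\prod_{r=1}^{k-2}(q)_{N_r-N_{r+1}}\big)(q)_{N_{k-1}}$. The identity is one of formal power series in $x$ and $q$. *)

(* Defs.v *)
From HB Require Import structures.
From mathcomp Require Import all_boot all_order all_algebra.
From mathcomp Require Import boolp classical_sets functions cardinality fsbigop.

Set Implicit Arguments.
Unset Strict Implicit.
Unset Printing Implicit Defensive.

Import GRing.Theory.
Local Open Scope ring_scope.

(* Formal power series. A series coerces to its coefficient function, so that
   [F m n] is the coefficient of x^m q^n of [F : {fps {fps R}}] when the outer
   variable is x and the inner variable is q. *)

Record fps (R : Type) := FPS { fpscoef :> nat -> R }.

Notation "{ 'fps' R }" := (fps R%type) (at level 0, format "{ 'fps'  R }").

Lemma fpsP (R : Type) (f g : {fps R}) : f =1 g <-> f = g.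
Proof. by split=> [|->//]; case: f g => f [g] /= /funext ->. Qed.

HB.instance Definition _ (R : Type) := gen_eqMixin {fps R}.
HB.instance Definition _ (R : Type) := gen_choiceMixin {fps R}.

Section FpsZmodule.
Variable R : zmodType.
Implicit Types f g : {fps R}.

Definition fps_zero : {fps R} := FPS (fun=> 0).
Definition fps_opp f : {fps R} := FPS (fun n => - f n).
Definition fps_add f g : {fps R} := FPS (fun n => f n + g n).

Fact fps_addA : associative fps_add.
Proof. by move=> f g h; apply/fpsP => n /=; rewrite addrA. Qed.
Fact fps_addC : commutative fps_add.
Proof. by move=> f g; apply/fpsP => n /=; rewrite addrC. Qed.
Fact fps_add0 : left_id fps_zero fps_add.
Proof. by move=> f; apply/fpsP => n /=; rewrite add0r. Qed.
Fact fps_addN : left_inverse fps_zero fps_opp fps_add.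
Proof. by move=> f; apply/fpsP => n /=; rewrite addNr. Qed.

HB.instance Definition _ :=
  GRing.isZmodule.Build {fps R} fps_addA fps_addC fps_add0 fps_addN.

Lemma fps_coef0 n : (0 : {fps R}) n = 0. Proof. by []. Qed.
Lemma fps_coefD f g n : (f + g) n = f n + g n. Proof. by []. Qed.
Lemma fps_coefN f n : (- f) n = - f n. Proof. by []. Qed.
Lemma fps_coefB f g n : (f - g) n = f n - g n. Proof. by []. Qed.
Lemma fps_coef_sum I (r : seq I) (P : pred I) (F : I -> {fps R}) n :
  (\sum_(i <- r | P i) F i) n = \sum_(i <- r | P i) F i n.
Proof. by elim/big_rec2: _ => //= i y f _ <-. Qed.

End FpsZmodule.


Section FpsRing.
Variable R : comNzRingType.
Implicit Types f g h : {fps R}.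

Definition fps_one : {fps R} := FPS (fun n => (n == 0%N)%:R).
Definition fps_mul f g : {fps R} :=
  FPS (fun n => \sum_(i < n.+1) f i * g (n - i)%N).

Let trunc n f : {poly R} := \poly_(i < n.+1) f i.

Let truncE n f i : (i <= n)%N -> (trunc n f)`_i = f i.
Proof. by move=> le_in; rewrite coef_poly ltnS le_in. Qed.

Let fps_mulE n f g i :
  (i <= n)%N -> fps_mul f g i = (trunc n f * trunc n g)`_i.
Proof.
move=> le_in; rewrite coefM; apply: eq_bigr => j _.
have le_ji : (j <= i)%N by rewrite -ltnS.
by rewrite !truncE ?(leq_trans _ le_in) ?leq_subr.
Qed.

Fact fps_mulC : commutative fps_mul.
Proof. by move=> f g; apply/fpsP => n; rewrite !(@fps_mulE n) // mulrC. Qed.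

Fact fps_mulA : associative fps_mul.
Proof.
move=> f g h; apply/fpsP => n.
transitivity (trunc n f * (trunc n g * trunc n h))`_n; last first.
  rewrite mulrA coefM; apply: eq_bigr => i _.
  by rewrite (@fps_mulE n) ?truncE ?leq_subr // -ltnS.
rewrite coefM; apply: eq_bigr => i _.
by rewrite (@fps_mulE n) ?truncE ?leq_subr // -ltnS.
Qed.

Fact fps_mul1 : left_id fps_one fps_mul.
Proof.
move=> f; apply/fpsP => n /=.
rewrite big_ord_recl /= mul1r subn0 big1 ?addr0 // => i _.
by rewrite /= mul0r.
Qed.

Fact fps_mulDl : left_distributive fps_mul +%R.
Proof.
move=> f g h; apply/fpsP => n /=; rewrite -big_split /=.
by apply: eq_bigr => i _; rewrite mulrDl.
Qed.

Fact fps_one_neq0 : fps_one != 0.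
Proof.
by apply/eqP => /fpsP/(_ 0%N)/= /eqP; rewrite oner_eq0.
Qed.

HB.instance Definition _ := GRing.Zmodule_isComNzRing.Build {fps R}
  fps_mulA fps_mulC fps_mul1 fps_mulDl fps_one_neq0.

Definition fpsC (c : R) : {fps R} := FPS (fun n => if n is 0 then c else 0).
Definition fpsX : {fps R} := FPS (fun n => (n == 1%N)%:R).

Lemma fps_coef1 n : (1 : {fps R}) n = (n == 0%N)%:R. Proof. by []. Qed.
Lemma fps_coefM f g n : (f * g) n = \sum_(i < n.+1) f i * g (n - i)%N.
Proof. by []. Qed.

Lemma fps_coefM_eq f f' g g' n :
  (forall i, (i <= n)%N -> f i = f' i) -> (forall i, (i <= n)%N -> g i = g' i) ->
  (f * g) n = (f' * g') n.
Proof.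
move=> ff' gg'; apply: eq_bigr => i _.
by rewrite ff' ?gg' ?leq_subr // -ltnS.
Qed.

Lemma fps_coef0M f g : (f * g) 0%N = f 0%N * g 0%N.
Proof. by rewrite fps_coefM big_ord1. Qed.

Lemma fps_coefXM f n : (fpsX * f) n = if n is n'.+1 then f n' else 0.
Proof.
rewrite fps_coefM big_ord_recl mul0r add0r; case: n => [|n]; first by rewrite big_ord0.
rewrite big_ord_recl /= mul1r big1 ?addr0 ?subSS ?subn0 // => i _.
by rewrite mul0r.
Qed.

Lemma fps_coefXnM f d n :
  (fpsX ^+ d * f) n = if (n < d)%N then 0 else f (n - d)%N.
Proof.
elim: d n => [|d IHd] n; first by rewrite expr0 mul1r subn0.
by rewrite exprS -mulrA fps_coefXM; case: n => [|n] //; rewrite IHd.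
Qed.

Lemma fps_coefXn d n : (fpsX ^+ d) n = (n == d)%:R.
Proof.
rewrite -[fpsX ^+ d]mulr1 fps_coefXnM fps_coef1 subn_eq0.
by case: ltngtP.
Qed.

Lemma fps_coefCM c f n : (fpsC c * f) n = c * f n.
Proof.
rewrite fps_coefM big_ord_recl subn0 big1 ?addr0 // => i _.
by rewrite mul0r.
Qed.

Lemma fps_exp_coef_eq0 f n k : f 0%N = 0 -> (n < k)%N -> (f ^+ k) n = 0.
Proof.
move=> f0; elim: k n => // k IHk n lt_nk.
rewrite exprS fps_coefM big_ord_recl f0 mul0r add0r big1 // => i _.
rewrite IHk ?mulr0 // lift0 (leq_trans _ (lt_nk : n <= k)%N) //.
by case: n i {lt_nk} => [[]//|n] i; rewrite subSS ltnS leq_subr.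
Qed.

End FpsRing.

Arguments fpsX {R}.

Section FpsUnitRing.
Variable R : comUnitRingType.
Implicit Types f g : {fps R}.

Definition fps_unit : {pred {fps R}} := fun f => f 0%N \is a GRing.unit.

(* 1 / f = f_0^-1 * \sum_k (1 - f_0^-1 f)^k, where the terms with k > n do not
   contribute to the n-th coefficient. *)
Definition fps_inv f : {fps R} :=
  if f \in fps_unit then
    FPS (fun n => (f 0%N)^-1 *
                  (\sum_(k < n.+1) (1 - fpsC (f 0%N)^-1 * f) ^+ k) n)
  else f.

Fact fps_mulV : {in fps_unit, left_inverse 1 fps_inv *%R}.
Proof.
move=> f uf; rewrite /fps_inv uf; move: (uf); rewrite unfold_in => u0.
set c := (f 0%N)^-1; set u := 1 - fpsC c * f.
have u0E : u 0%N = 0 by rewrite fps_coefB fps_coefCM /c mulVr // subrr.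
apply/fpsP => n; pose S := \sum_(k < n.+1) u ^+ k.
rewrite (@fps_coefM_eq _ _ (fpsC c * S) f f n) => // [|i le_in]; last first.
  rewrite fps_coefCM /=; congr (c * _).
  rewrite /S -2!(big_mkord xpredT (fun k => u ^+ k)).
  rewrite [in RHS](big_cat_nat (n := i.+1)) // fps_coefD.
  rewrite [X in _ = _ + X]fps_coef_sum [X in _ = _ + X]big_nat.
  rewrite [X in _ = _ + X]big1 ?addr0 // => k /andP[lt_ik _].
  exact: fps_exp_coef_eq0.
rewrite mulrAC; have -> : fpsC c * f = 1 - u by rewrite /u opprB addrC subrK.
have -> : (1 - u) * S = 1 - u ^+ n.+1.
  by rewrite -(opprB u) mulNr -subrX1 opprB.
by rewrite fps_coefB (fps_exp_coef_eq0 u0E) // subr0.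
Qed.

Fact fps_unitPl f g : g * f = 1 -> fps_unit f.
Proof.
move=> /fpsP/(_ 0%N); rewrite fps_coef0M fps_coef1 => gf1.
by apply/unitrP; exists (g 0%N); rewrite [f 0%N * _]mulrC.
Qed.

Fact fps_inv_out : {in [predC fps_unit], fps_inv =1 id}.
Proof. by move=> f; rewrite inE /fps_inv => /negbTE ->. Qed.

HB.instance Definition _ := GRing.ComNzRing_hasMulInverse.Build {fps R}
  fps_mulV fps_unitPl fps_inv_out.

Lemma fps_unitE f : (f \is a GRing.unit) = (f 0%N \is a GRing.unit).
Proof. by []. Qed.

End FpsUnitRing.

Arguments fpscoef {R} f n : simpl never.

Lemma fpsE (R : Type) (f : nat -> R) n : (FPS f) n = f n. Proof. by []. Qed.

(* The family F of bivariate series, indexed by A, is summable with sum S: each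
   monomial x^m q^n occurs in finitely many F i only, and the coefficients of
   that monomial add up to the one in S. *)
Definition fps2_has_sum (R : comNzRingType) (I : choiceType) (A : set I)
    (F : I -> {fps {fps R}}) (S : {fps {fps R}}) : Prop :=
  forall m n : nat,
    finite_set (A `&` [set i | F i m n != 0])%classic /\
    \sum_(i \in A) F i m n = S m n.

(* q-Pochhammer symbols, in Q[[q]]. *)

Local Notation q := (@fpsX rat).

(* (a)_oo: the factors 1 - a q^j with j > n do not contribute to the
   coefficient of q^n. *)
Definition qpoch_inf (a : {fps rat}) : {fps rat} :=
  FPS (fun n => (\prod_(j < n.+1) (1 - a * q ^+ j)) n).

Definition qpoch (a : {fps rat}) (n : nat) : {fps rat} :=
  qpoch_inf a / qpoch_inf (a * q ^+ n).

(* (-q)_(N-1) = (-q)_oo / (-q q^(N-1))_oo. Writing -q q^(N-1) as -q^N keeps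
   everything in Q[[q]], including for N = 0. *)
Definition qpoch_mq_pred (N : nat) : {fps rat} :=
  qpoch_inf (- q) / qpoch_inf (- q ^+ N).

Lemma qpoch_inf_coef a n N : (n < N)%N ->
  qpoch_inf a n = (\prod_(j < N) (1 - a * q ^+ j)) n.
Proof.
elim: N => // N IHN; rewrite ltnS leq_eqVlt => /predU1P[->//|lt_nN].
rewrite big_ord_recr /= mulrBr mulr1 fps_coefB -IHN // mulrA mulrC.
by rewrite fps_coefXnM lt_nN subr0.
Qed.

Lemma qpoch_inf_recl a : qpoch_inf a = (1 - a) * qpoch_inf (a * q).
Proof.
apply/fpsP => n; rewrite (@qpoch_inf_coef _ _ n.+2) // big_ord_recl expr0 mulr1.
apply: fps_coefM_eq => // i le_in; rewrite (@qpoch_inf_coef _ _ n.+1) //.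
by under [in RHS]eq_bigr => j _ do rewrite -mulrA -exprS.
Qed.

Lemma qpoch_inf_split a n :
  qpoch_inf a = (\prod_(j < n) (1 - a * q ^+ j)) * qpoch_inf (a * q ^+ n).
Proof.
elim: n => [|n IHn]; first by rewrite big_ord0 mul1r expr0 mulr1.
by rewrite big_ord_recr /= -mulrA exprSr [a * (_ * _)]mulrA -qpoch_inf_recl.
Qed.

Lemma qpoch_inf_unit a : (qpoch_inf a \is a GRing.unit) = (a 0%N != 1).
Proof.
rewrite fps_unitE fpsE big_ord1 expr0 mulr1 fps_coefB unitfE subr_eq0.
by rewrite eq_sym.
Qed.

Lemma qpochE a n : (a * q ^+ n) 0%N != 1 ->
  qpoch a n = \prod_(j < n) (1 - a * q ^+ j).
Proof.
by move=> an1; rewrite /qpoch (qpoch_inf_split a n) mulrK ?qpoch_inf_unit.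
Qed.

Lemma qpoch_q n : qpoch q n = \prod_(1 <= j < n.+1) (1 - q ^+ j).
Proof.
rewrite qpochE; last by rewrite fps_coefXM eq_sym oner_eq0.
by rewrite big_add1 big_mkord; under eq_bigr do rewrite -exprS.
Qed.

Lemma qpoch_mq_predS n :
  qpoch_mq_pred n.+1 = \prod_(1 <= j < n.+1) (1 + q ^+ j).
Proof.
rewrite /qpoch_mq_pred exprS -mulNr -/(qpoch _ n) qpochE; last first.
  by rewrite mulNr fps_coefN fps_coefXM oppr0 eq_sym oner_eq0.
rewrite big_add1 big_mkord; apply: eq_bigr => j _.
by rewrite mulNr opprK exprS.
Qed.

Lemma qpoch_mq_pred0 : qpoch_mq_pred 0 = fpsC 2^-1.
Proof.
have u2 : qpoch_inf (- 1) \is a GRing.unit by rewrite qpoch_inf_unit.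
rewrite /qpoch_mq_pred expr0; apply: (canLR (mulrK u2)).
rewrite [in RHS]qpoch_inf_recl mulN1r opprK mulrA.
suff -> : fpsC 2^-1 * (1 + 1) = 1 :> {fps rat} by rewrite mul1r.
by apply/fpsP => -[|n]; rewrite fps_coefCM fps_coefD.
Qed.

(* Overpartitions: a part is a pair (numerical value, is it overlined). *)

Definition part : Type := (nat * bool)%type.
Definition part_val (d : seq part) (j : nat) : nat := (nth (0%N, false) d j).1.
Definition part_over (d : seq part) (j : nat) : bool := (nth (0%N, false) d j).2.

(* Only the first occurrence of a value may be overlined; that this occurrence
   is listed before the other ones is the ordering convention for parts. *)
Definition is_overpartition (n : nat) (d : seq part) : bool :=
  [&& sorted geq (map fst d), all (fun p : part => (0 < p.1)%N) d,
      sumn (map fst d) == n &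
      all (fun j => part_over d j ==> (index (part_val d j) (map fst d) == j)%N)
        (iota 0 (size d))].

(* With 0-based indices, 1 <= j <= m - k + 1 reads j + (k - 1) < m. *)
Definition overpart_D_cond (k i : nat) (d : seq part) : bool :=
  (count_mem (1%N, false) d <= i.-1)%N &&
  all (fun j => (part_val d (j + k.-1) + (if part_over d j then 1 else 2)
                 <= part_val d j)%N)
    (iota 0 (size d - k.-1)%N).

(* D_{k,i}(m,n); bounding the values by n loses nothing, since no part of an
   overpartition of n exceeds n. *)
Definition overpart_D (k i m n : nat) : nat :=
  #|[set d : m.-tuple ('I_n.+1 * bool) |
     let d' := [seq (nat_of_ord p.1, p.2) | p <- d] in
     is_overpartition n d' && overpart_D_cond k i d']|.

Definition overpart_D_gf (k i : nat) : {fps {fps rat}} :=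
  FPS (fun m => FPS (fun n => (overpart_D k i m n)%:R)).

(* N_r for 1 <= r < k; out of range it is 0, whence the convention N_k = 0. *)
Definition Nr (k : nat) (N : k.-1.-tuple nat) (r : nat) : nat := nth 0%N N r.-1.

Definition multisum_index (k : nat) : set (k.-1.-tuple nat) :=
  [set N | sorted geq N]%classic.

Arguments multisum_index k _ : clear implicits.

Definition multisum_exponent (k i : nat) (N : k.-1.-tuple nat) : nat :=
  (((Nr N 1 + 1) * Nr N 1) %/ 2 + \sum_(2 <= r < k) Nr N r ^ 2
   + \sum_(i.+1 <= r < k) Nr N r)%N.

Definition multisum_denom (k : nat) (N : k.-1.-tuple nat) : {fps rat} :=
  (\prod_(1 <= r < k.-1) qpoch q (Nr N r - Nr N r.+1)%N) * qpoch q (Nr N k.-1).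

Definition multisum_term (k i : nat) (N : k.-1.-tuple nat) : {fps {fps rat}} :=
  fpsC (q ^+ multisum_exponent i N * qpoch_mq_pred (Nr N 1)
        * (1 + q ^+ Nr N i) / multisum_denom N)
  * fpsX ^+ (\sum_(1 <= r < k) Nr N r)%N.

(* Main.v *)
Require Import Defs.
From HB Require Import structures.
From mathcomp Require Import all_boot all_order all_algebra.
From mathcomp Require Import boolp classical_sets functions cardinality fsbigop.
From mathcomp Require Import ring zify.

(* Write F_i for the generating function of D_(k,i). In terms of the numbers f_t
   and g_t of non-overlined and overlined parts t, the gap condition reads
   f_(t+1) + g_t + f_t <= k - 1; removing the parts equal to 1 and lowering the
   others by 1 gives
     F_(i+1)(x) - F_i(x) = (xq)^i F_(k-i)(xq) + (xq)^(i+1) F_(k-i-1)(xq),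
   with F_0 = 0, and this recursion determines the F_i.

   The multisum satisfies the same recursion by induction on k. Splitting off the
   innermost index n = N_(k-1) turns the multisum for k into a sum over n of
   multisums for k - 1 with x replaced by x q^(2n). As (-q)_(N_1 - 1) is not
   preserved by this, the factor q^(N(N+1)/2) (-q)_(N-1) is deformed to
   prod_(j < N) q^(j+1) (x q^j + v), whose second variable becomes v q^n.
   Two q-difference equations, [Arec] and [Qrec], are then proved simultaneously;
   at v = x they combine into the recursion for F_i. *)

Set Implicit Arguments.
Unset Strict Implicit.
Unset Printing Implicit Defensive.

Import GRing.Theory.

(** * Overpartitions as sorted lists, and the gap condition as a count *)

Section Overpartitions.
Implicit Types (d e : seq part) (p : part) (k i m n f : nat) (b : bool).

(** After a part of the same value only a non-overlined part may follow. Sortedness for this single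
    relation thus encodes both the weakly decreasing values and the rule that only a first
    occurrence is overlined; it is not reflexive at overlined parts. *)
Definition part_geq : rel part :=
  fun p p' => (p'.1 < p.1)%N || ((p'.1 == p.1) && ~~ p'.2).

Lemma part_geq_trans : transitive part_geq.
Proof.
move=> [b ob] [a oa] [c oc]; rewrite /part_geq /= => /orP[lt_ba|/andP[/eqP-> nob]] //.
case/orP=> [lt_cb|/andP[/eqP-> _]]; last by rewrite lt_ba.
by rewrite (ltn_trans lt_cb).
Qed.

Definition positive_parts d := all (fun p : part => (0 < p.1)%N) d.

Lemma sorted_part_geq p d :
  sorted part_geq (p :: d) = all (part_geq p) d && sorted part_geq d.
Proof. exact/path_sortedE/part_geq_trans. Qed.

Lemma all_iota_nth (a : pred part) d :
  all a d = all (fun j => a (nth (0%N, false) d j)) (iota 0 (size d)).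
Proof. by rewrite -{1}[d](mkseq_nth (0%N, false)) all_map. Qed.

Definition first_over d := all (fun j => part_over d j ==>
  (index (part_val d j) (map fst d) == j)%N) (iota 0 (size d)).

Lemma first_over_cons p d : first_over (p :: d) =
  all (fun p' : part => p'.2 ==> (p'.1 != p.1)) d && first_over d.
Proof.
rewrite /first_over /= eqxx implybT /= -[1%N]addn0 iotaDl all_map all_iota_nth.
rewrite -all_predI; apply: eq_in_all => j; rewrite mem_iota /= add0n => lt_jd.
rewrite /part_over /part_val /=; case: (nth _ d j) => v [] //=.
by rewrite [v == _]eq_sym; case: (p.1 =P v).
Qed.

Lemma is_overpartitionE n d : is_overpartition n d =
  [&& sorted part_geq d, positive_parts d & sumn (map fst d) == n].
Proof.
rewrite /is_overpartition -/(first_over d) -/(positive_parts d).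
suff -> : sorted part_geq d = sorted geq (map fst d) && first_over d.
  by rewrite andbCA [RHS]andbC -!andbA; do !bool_congr.
elim: d => // p d IHd; rewrite sorted_part_geq first_over_cons IHd /=.
rewrite path_sortedE; last by move=> a c e /= ac ce; apply: leq_trans ce ac.
rewrite andbACA all_map -all_predI; congr (_ && _).
apply: eq_in_all => -[v o] _ /=; rewrite /part_geq /= ltn_neqAle.
by case: eqP => [->|_] /=; rewrite ?leqnn /= ?andbT; case: o; rewrite /= ?orbF ?andbT.
Qed.

Definition gap_width p : nat := if p.2 then 1 else 2.

(** On a list headed by [p], the part [p] is close to itself; the bound [< k] in [gap_cond]
    therefore allows at most k - 2 close parts after it. *)
Definition close_parts p d := count (fun p' : part => (p.1 < p'.1 + gap_width p)%N) d.

(* The gap condition at [p] only bounds the number of parts too close below it,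
   which avoids index arithmetic. *)
Fixpoint gap_cond k d : bool :=
  if d is p :: d' then (close_parts p d < k)%N && gap_cond k d' else true.

Lemma geq_trans : transitive geq.
Proof. by move=> a c e /= ac ce; apply: leq_trans ce ac. Qed.

(** An upward closed predicate holds exactly on an initial segment of a non-increasing list. *)
Lemma nth_sorted_count (P : pred nat) (s : seq nat) j :
    (forall a c, (a <= c)%N -> P a -> P c) -> sorted geq s -> (j < size s)%N ->
  P (nth 0%N s j) = (j < count P s)%N.
Proof.
move=> Pmono; elim: s j => // a s IHs j; rewrite /= (path_sortedE geq_trans).
case/andP=> /allP le_sa sorts; case: (boolP (P a)) => [Pa|nPa].
  by case: j => //= j lt_j; rewrite IHs.
have nPs : count P s = 0%N.
  apply/eqP; rewrite -leqn0 leqNgt -has_count; apply/hasPn => c /le_sa /= le_ca.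
  by apply: contra nPa; apply: Pmono.
rewrite nPs; case: j => [|j] /= lt_j; first exact: negbTE.
by apply/negbTE; apply: contra nPa; apply/Pmono/le_sa/mem_nth.
Qed.

(** The close parts form an initial segment of the list headed by [p], so the part k - 1 places
    further violates the gap exactly when at least k parts are close. If there is no such part, the
    count is below k for lack of parts. *)
Lemma gap_condE k d : (0 < k)%N -> sorted geq (map fst d) ->
  all (fun j => (part_val d (j + k.-1) + (if part_over d j then 1 else 2)
                 <= part_val d j)%N) (iota 0 (size d - k.-1)%N) = gap_cond k d.
Proof.
case: k => // k _; elim: d => // p d IHd sortd.
have sortd' : sorted geq (map fst d) by move: sortd => /= /path_sorted.
rewrite [gap_cond _ _]/= -IHd //= {IHd}.
have [le_kd|lt_dk] := leqP k (size d); last first.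
  have -> : ((size d).+1 - k = 0)%N by lia.
  have -> : (size d - k = 0)%N by lia.
  rewrite /= andbT; apply/esym; rewrite ltnS; apply: leq_trans lt_dk.
  exact: (count_size _ (p :: d)).
rewrite subSn //= -[1%N]addn0 iotaDl all_map; congr (_ && _).
rewrite add0n ltnS leqNgt [RHS]leqNgt; congr (~~ _).
have := @nth_sorted_count (fun a => p.1 < a + gap_width p)%N _ k _ sortd.
rewrite count_map size_map /= ltnS => <- //; last by move=> a c; lia.
by rewrite /part_val (nth_map (0%N, false) 0%N fst (s := p :: d)).
Qed.

(** * Removing the parts equal to 1 and lowering the others *)

Definition up e : seq part := [seq (p.1.+1, p.2) | p <- e].
Definition ones b f : seq part := nseq b (1%N, true) ++ nseq f (1%N, false).
(** Inverse of that removal; the boolean [b] also serves as the number of overlined ones. *)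
Definition join b f e : seq part := up e ++ ones b f.

Lemma size_join b f e : size (join b f e) = (size e + (b + f))%N.
Proof. by rewrite /join /ones !size_cat size_map !size_nseq. Qed.

Lemma join_cons b f p e : join b f (p :: e) = (p.1.+1, p.2) :: join b f e.
Proof. by []. Qed.

Lemma join_inj b f : injective (join b f).
Proof.
move=> e e' E; have := congr1 size E; rewrite !size_join => /addIn sE.
move/eqP: E; rewrite eqseq_cat ?size_map // eqxx andbT => /eqP; apply: inj_map.
by case=> [v o] [v' o'] [-> ->].
Qed.

Lemma sumn_join b f e :
  sumn (map fst (join b f e)) = (sumn (map fst e) + (size e + (b + f)))%N.
Proof.
rewrite /join /ones !map_cat !map_nseq !sumn_cat !sumn_nseq !mul1n.
suff -> : sumn (map fst (up e)) = (sumn (map fst e) + size e)%N by rewrite -!addnA.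
by elim: e => //= p e ->; lia.
Qed.

Lemma positive_join b f e : positive_parts (join b f e).
Proof.
rewrite /positive_parts /join /ones !all_cat !all_nseq /= !orbT !andbT.
by apply/allP => _ /mapP[p _ ->].
Qed.

Lemma count_over_join b f e : positive_parts e ->
  count_mem (1%N, true) (join b f e) = b.
Proof.
move=> pe; rewrite /join /ones !count_cat !count_nseq /=.
rewrite (_ : count _ (up e) = 0%N) ?mul1n ?mul0n ?addn0 //.
apply/eqP; rewrite -leqn0 leqNgt -has_count; apply/hasPn => _ /mapP[p pin ->].
by have := allP pe p pin; case: p {pin} => [[]].
Qed.

Lemma count_nonover_join b f e : positive_parts e ->
  count_mem (1%N, false) (join b f e) = f.
Proof.
move=> pe; rewrite /join /ones !count_cat !count_nseq /=.
rewrite (_ : count _ (up e) = 0%N) ?mul1n ?mul0n ?addn0 //.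
apply/eqP; rewrite -leqn0 leqNgt -has_count; apply/hasPn => _ /mapP[p pin ->].
by have := allP pe p pin; case: p {pin} => [[]].
Qed.

Lemma sorted_ones b f : sorted part_geq (ones b f).
Proof.
have sf : sorted part_geq (nseq f (1%N, false)).
  by elim: f => // f IHf; rewrite sorted_part_geq IHf andbT all_nseq orbT.
by case: b => //; rewrite sorted_part_geq sf andbT all_nseq orbT.
Qed.

Lemma sorted_join b f e : positive_parts e ->
  sorted part_geq (join b f e) = sorted part_geq e.
Proof.
elim: e => [|p e IHe]; first by rewrite sorted_ones.
case/andP=> p0 pe; rewrite join_cons !sorted_part_geq IHe //; congr (_ && _).
rewrite /join /ones !all_cat all_map !all_nseq /part_geq /=.
rewrite (_ : (1 < p.1.+1)%N = true) ?ltnS // !orbT !andbT.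
by apply: eq_all => p'.
Qed.

Lemma join_surj d : sorted part_geq d -> positive_parts d ->
  exists b f e, [/\ d = join b f e & positive_parts e].
Proof.
elim: d => [|[v o] d IHd]; first by exists false, 0%N, [::].
rewrite sorted_part_geq => /andP[/allP le_d sd] /andP[/= v0 pd].
have [b [f [e [dE pe]]]] := IHd sd pd.
case: v v0 le_d => [//|[|v]] _ le_d; last first.
  by exists b, f, ((v.+1, o) :: e); rewrite dE.
(* A head equal to 1 can be followed only by non-overlined ones. *)
have e0 : e = [::].
  case: e dE pe => // p e dE /andP[p0 _].
  by have := le_d (p.1.+1, p.2); rewrite dE /= mem_head /part_geq /= => /(_ isT); lia.
have b0 : b = false.
  apply: contraTF isT => bT; have := le_d (1%N, true).
  by rewrite dE e0 bT /join /= mem_head /part_geq /= => /(_ isT).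
rewrite dE e0 b0; case: o {le_d}; first by exists true, f, [::].
by exists false, f.+1, [::].
Qed.

Lemma gap_cond_ones k b f : (0 < k)%N -> gap_cond k (ones b f) = (b + f < k)%N.
Proof.
move=> k0; have gf : gap_cond k (nseq f (1%N, false)) = (f < k)%N.
  elim: f => [|f IHf] /=; first by rewrite k0.
  by rewrite IHf /close_parts /= count_nseq mul1n add1n andb_idr // => /ltnW.
case: b => //=; rewrite gf /close_parts /= count_nseq mul1n add1n andb_idr //.
by move=> /ltnW.
Qed.

(** A raised part has value at least 2, hence is close to a 1 only if it is a non-overlined 2, that
    is, if [p] is a non-overlined 1. *)
Lemma close_parts_join b f p e : (0 < p.1)%N ->
  close_parts (p.1.+1, p.2) (join b f e) =
  (close_parts p e + (p == (1%N, false)) * (b + f))%N.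
Proof.
move=> p0; rewrite /close_parts /join /ones !count_cat count_map !count_nseq.
rewrite /gap_width /=; congr (_ + _)%N.
case: p p0 => [[|[|v]] []] //= _; rewrite ?mul1n ?mul0n //.
Qed.

Lemma gap_cond_cons k p d :
  gap_cond k (p :: d) = (close_parts p (p :: d) < k)%N && gap_cond k d.
Proof. by []. Qed.

(** Only the non-overlined ones of [e] acquire new close parts. They end the list, and the first of
    them gives the strongest bound: this is f_2 + g_1 + f_1 <= k - 1 for the joined list. It becomes
    the bound on the ones of [e], whence the new second parameter k - (b + f) in [valid_join]. *)
Lemma gap_cond_join k b f e : (0 < k)%N -> positive_parts e -> sorted part_geq e ->
  gap_cond k (join b f e) = gap_cond k e && (count_mem (1%N, false) e < k - (b + f))%N.
Proof.
move=> k0; elim: e => [_ _|p e IHe].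
  by rewrite gap_cond_ones //= subn_gt0.
case/andP=> p0 pe; rewrite sorted_part_geq => /andP[le_e se].
rewrite join_cons !gap_cond_cons IHe // -join_cons close_parts_join //.
rewrite [count_mem _ (p :: e)]/=; case: (p =P (1%N, false)) => [pE|_]; last first.
  by rewrite mul0n addn0 add0n andbA.
have eE : e = nseq (size e) (1%N, false).
  apply/all_pred1P/allP => p' p'e /=.
  have := allP le_e p' p'e; have := allP pe p' p'e; rewrite pE /part_geq /=.
  by case: p' {p'e} => [[|[|v]] []].
have -> : close_parts p (p :: e) = (size e).+1.
  rewrite /close_parts pE /= {1}eE count_nseq /=; lia.
have -> : count_mem (1%N, false) e = size e by rewrite {1}eE count_nseq /= mul1n.
by case: (gap_cond k e); rewrite ?andbF ?andbT /=; lia.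
Qed.


(** * Enumeration of the overpartitions and their recursion *)

Definition valid k i m n d := [&& size d == m, sorted part_geq d, positive_parts d,
  sumn (map fst d) == n, (count_mem (1%N, false) d < i)%N & gap_cond k d].

(* For i = 0, where [overpart_D] (through [i.-1]) would repeat the case i = 1, the
   recursion needs the empty list. *)
Definition overparts k i m n : seq (seq part) :=
  if i is 0 then [::] else
  [seq [seq (nat_of_ord u.1, u.2) | u <- val t] |
    t <- enum [set t : m.-tuple ('I_n.+1 * bool) |
     let d' := [seq (nat_of_ord u.1, u.2) | u <- t] in
     is_overpartition n d' && overpart_D_cond k i d']].

Lemma size_overparts k i m n :
  size (overparts k i m n) = if i is 0 then 0%N else overpart_D k i m n.
Proof. by case: i => // i; rewrite size_map -cardE. Qed.

Lemma uniq_overparts k i m n : uniq (overparts k i m n).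
Proof.
case: i => // i; rewrite map_inj_uniq ?enum_uniq // => t t' E; apply: val_inj.
by apply: inj_map E => -[a b] [a' b'] [/val_inj-> ->].
Qed.

Lemma mem_overparts k i m n d : (0 < k)%N ->
  (d \in overparts k i m n) = valid k i m n d.
Proof.
move=> k0; case: i => [|i]; first by rewrite /valid ltn0 /= !andbF.
have condE d' : is_overpartition n d' && overpart_D_cond k i.+1 d' =
  [&& sorted part_geq d', positive_parts d', sumn (map fst d') == n,
      (count_mem (1%N, false) d' < i.+1)%N & gap_cond k d'].
  rewrite /overpart_D_cond; apply/idP/idP.
    case/and3P=> od; have /andP[sd _] := od; rewrite gap_condE // => cd gd.
    by move: od; rewrite is_overpartitionE => /and3P[-> -> ->]; rewrite gd andbT.
  case/and5P=> sd pd nd cd gd.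
  have od : is_overpartition n d' by rewrite is_overpartitionE sd pd.
  by rewrite od /= -ltnS cd gap_condE //; case/andP: od.
apply/mapP/idP => [[t]|/andP[/eqP sd vd]].
  by rewrite mem_enum inE /= condE => vt ->; rewrite /valid size_map size_tuple eqxx.
have le_n : all (fun p : part => p.1 < n.+1)%N d.
  case/and5P: vd => _ _ /eqP <- _ _; elim: d {sd} => //= p d IHd.
  rewrite ltnS leq_addr /=; apply: sub_all IHd => p' /= lt.
  by apply: leq_trans lt _; rewrite ltnS leq_addl.
have sd' : size [seq (inord p.1 : 'I_n.+1, p.2) | p <- d] == m by rewrite size_map sd.
have dE : d = [seq (nat_of_ord u.1, u.2) | u <- Tuple sd'].
  rewrite /= -map_comp -[LHS]map_id; apply/eq_in_map => p /(allP le_n) /= lt.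
  by rewrite inordK //; case: p {lt}.
by exists (Tuple sd') => //; rewrite mem_enum inE /= condE -dE.
Qed.

Lemma valid_join k i m n b f e : (0 < k)%N -> positive_parts e ->
  valid k i m n (join b f e) = [&& (b + f <= m)%N, (m <= n)%N, (f < i)%N &
    valid k (k - (b + f)) (m - (b + f)) (n - m) e].
Proof.
move=> k0 pe; rewrite /valid size_join sorted_join // positive_join sumn_join pe.
rewrite count_nonover_join //; case se : (sorted part_geq e); last by rewrite !andbF.
rewrite gap_cond_join //; case: (gap_cond k e); last by rewrite !andbF.
rewrite /= andbT; case: (_ < k - _)%N; last by rewrite !andbF.
by case: (f < i)%N; rewrite /= ?andbF ?andbT //; apply/idP/idP; lia.
Qed.

Lemma positive_overparts k i m n e : (0 < k)%N ->
  e \in overparts k i m n -> positive_parts e.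
Proof. by move=> k0; rewrite mem_overparts // => /and3P[_ _ /andP[]]. Qed.

(** At most i non-overlined ones means fewer than i, or exactly i without an overlined 1
    ([J false]), or exactly i with one ([J true]). In the last two cases lowering removes 1 from
    each of the m parts, so n drops by m. *)
Lemma size_overparts_rec k i m n : (0 < k)%N ->
  size (overparts k i.+1 m n) = (size (overparts k i m n) +
  (if (i <= m)%N && (m <= n)%N
   then size (overparts k (k - i) (m - i) (n - m)) else 0) +
  (if (i < m)%N && (m <= n)%N
   then size (overparts k (k - i.+1) (m - i.+1) (n - m)) else 0))%N.
Proof.
move=> k0; pose J b := if (b + i <= m)%N && (m <= n)%N then
  [seq join b i e | e <- overparts k (k - (b + i)) (m - (b + i)) (n - m)] else [::].
transitivity (size (overparts k i m n ++ J false ++ J true)); last first.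
  rewrite !size_cat addnA /J add0n add1n; do 2![case: ifP]; rewrite ?size_map //.
pose inJ b d := exists e, [/\ d = join b i e, positive_parts e & valid k i.+1 m n d].
have JP b d : reflect (inJ b d) (d \in J b).
  rewrite /J; apply: (iffP idP) => [|[e [-> pe]]]; last first.
    rewrite valid_join // => /and4P[-> -> _ ve] /=.
    by apply/mapP; exists e; rewrite // mem_overparts.
  case: ifP => // /andP[le_m le_n] /mapP[e ein ->].
  have pe := positive_overparts k0 ein; exists e; split=> //.
  by rewrite valid_join // le_m le_n ltnSn -mem_overparts.
have uniqJ b : uniq (J b).
  rewrite /J; case: ifP => // _.
  by rewrite map_inj_uniq ?uniq_overparts //; apply: join_inj.
apply: perm_size; apply: uniq_perm; first exact: uniq_overparts.
  rewrite cat_uniq uniq_overparts cat_uniq /=; apply/and4P; split.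
  - apply/hasPn => d; rewrite mem_cat => dJ; rewrite mem_overparts //.
    have [b [e [-> pe _]]] : exists b, inJ b d.
      by case/orP: dJ => /JP ?; [exists false|exists true].
    by rewrite valid_join // ltnn !andbF.
  - exact: uniqJ.
  - apply/hasPn => d /JP[e [dE pe _]]; apply/negP => /JP[e' [dE' pe' _]].
    by have := count_over_join true i pe; rewrite -dE dE' count_over_join.
  - exact: uniqJ.
move=> d; rewrite !mem_cat !mem_overparts //; apply/idP/or3P; last first.
  case=> [|/JP[e []]//|/JP[e []]//].
  by case/and5P=> h1 h2 h3 h4 /andP[h5 h6]; rewrite /valid h1 h2 h3 h4 h6 ltnW.
move=> vd; have /and5P[_ sd pd _ /andP[cd _]] := vd.
have [b [f [e [dE pe]]]] := join_surj sd pd.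
move: cd; rewrite {1}dE count_nonover_join // ltnS leq_eqVlt => /predU1P[fi|lt_fi].
  by rewrite fi in dE; case: b dE => dE; [apply: Or33|apply: Or32]; apply/JP; exists e.
apply: Or31; move: vd; rewrite dE !valid_join // lt_fi.
by case/and4P=> -> -> _ ->.
Qed.

Lemma size_overparts0 k i n : (0 < k)%N -> size (overparts k i.+1 0 n) = (n == 0).
Proof.
move=> k0; have mem d : (d \in overparts k i.+1 0 n) = (n == 0) && (d == [::]).
  rewrite mem_overparts // /valid; case: d => [|p d] /=; last by rewrite andbF.
  by rewrite eq_sym andbT.
case: eqP mem => [_|_] mem.
  have -> // : size (overparts k i.+1 0 n) = size [:: [::] : seq part].
  apply/perm_size/uniq_perm; rewrite ?uniq_overparts // => d.
  by rewrite mem inE.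
case: (overparts _ _ _ _) mem => // d s mem.
by have := mem d; rewrite mem_head.
Qed.

End Overpartitions.

Local Open Scope ring_scope.

(* What the argument needs of infinite sums of power series. Abstracting from
   [{fps R}] keeps unification from unfolding products of series. *)
Record summation (S : comNzRingType) := Summation {
  null : S -> Prop;
  summable : (nat -> S) -> Prop;
  fsum : (nat -> S) -> S;
  nullD : forall a b, null a -> null b -> null (a + b);
  nullMr : forall a b, null a -> null (a * b);
  summable_prod : forall a : nat -> S, (forall j, null (a j)) ->
    summable (fun n => \prod_(j < n) a j);
  summableMr : forall g h, summable g -> summable (fun n => g n * h n);
  eq_fsum : forall g h, g =1 h -> fsum g = fsum h;
  fsumD : forall g h, fsum g + fsum h = fsum (fun n => g n + h n);
  fsumMl : forall c g, summable g -> c * fsum g = fsum (fun n => c * g n);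
  fsum_recl : forall g, summable g -> fsum g = g 0%N + fsum (fun n => g n.+1)
}.

(** * The deformed weights and their q-shifts *)

Section Weights.
Variables (R : comUnitRingType) (q : R).
Implicit Types (x v : R) (K i n : nat).

Definition qfact n : R := \prod_(1 <= j < n.+1) (1 - q ^+ j).

Definition Wprod n x v : R := \prod_(j < n) (q ^+ j.+1 * (x * q ^+ j + v)).

(** Contribution of the innermost of K + 1 indices: all of them are at least n, the outermost one
    yields [Wprod], and each of the other K yields q^(n^2) x^n. *)
Definition gweight K n x v : R :=
  Wprod n x v * (q ^+ (n ^ 2)%N * x ^+ n) ^+ K / qfact n.

Lemma qexpE a b : a = b -> q ^+ a = q ^+ b. Proof. by move->. Qed.

(** Replacing x by x q shifts the factors x q^j + v by one place, so the two products differ only in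
    their end factors. *)
Lemma Wprod_recl n x v :
  Wprod n (x * q) v * (x + v) = Wprod n x v * (x * q ^+ n + v).
Proof.
elim: n => [|n IHn]; first by rewrite /Wprod !big_ord0 !mul1r expr0 mulr1.
rewrite /Wprod !big_ord_recr /= -!/(Wprod _ _ _) in IHn *.
by rewrite mulrAC IHn -[x * q * _]mulrA -exprS; ring.
Qed.

Lemma Wprod_scale n x v c : Wprod n (x * c) (v * c) = c ^+ n * Wprod n x v.
Proof.
elim: n => [|n IHn]; first by rewrite /Wprod !big_ord0 mulr1.
rewrite /Wprod !big_ord_recr /= -!/(Wprod _ _ _) in IHn *.
by rewrite IHn !exprS; ring.
Qed.

(** In the later factors, q^n moves into the bracket: q^n (x q^(n+j) + v) = x q^(2n) q^j + v q^n.
    This closes the two-variable family under splitting off n. *)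
Lemma Wprod_add m n x v :
  Wprod (n + m) x v = Wprod n x v * Wprod m (x * q ^+ (2 * n)%N) (v * q ^+ n).
Proof.
rewrite /Wprod big_split_ord /=; congr (_ * _); apply: eq_bigr => j _.
by rewrite -addnS mul2n -addnn !exprD; ring.
Qed.

Lemma gweight_scale K n x v :
  gweight K n (x * q) (v * q) = gweight K n x v * q ^+ (n * K.+1)%N.
Proof.
rewrite /gweight Wprod_scale [(x * q) ^+ n]exprMn !exprMn mulnS exprD exprM; ring.
Qed.

Lemma gweight_recl K n x v : (x + v) * gweight K n (x * q) v =
  gweight K n x v * (x * q ^+ n + v) * q ^+ (n * K)%N.
Proof.
transitivity ((Wprod n (x * q) v * (x + v)) *
   (q ^+ (n ^ 2)%N * (x * q) ^+ n) ^+ K / qfact n); first by rewrite /gweight; ring.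
by rewrite Wprod_recl /gweight !exprMn exprM; ring.
Qed.

Hypothesis q_unit : forall n, (1 - q ^+ n.+1) \is a GRing.unit.

Lemma qfact_unit n : qfact n \is a GRing.unit.
Proof.
rewrite /qfact big_add1 big_mkord.
by elim/big_rec: _ => [|j f _ uf]; rewrite ?unitr1 // unitrM q_unit.
Qed.

Lemma qfactS n : qfact n.+1 = qfact n * (1 - q ^+ n.+1).
Proof. by rewrite /qfact big_nat_recr. Qed.

Lemma gweightS K n x v : gweight K n.+1 x v * (1 - q ^+ n.+1) =
  gweight K n x v * q ^+ n.+1 * (x * q ^+ n + v) * (q ^+ (2 * n).+1 * x) ^+ K.
Proof.
have E : (qfact n.+1)^-1 * (1 - q ^+ n.+1) = (qfact n)^-1.
  by rewrite qfactS invrM ?qfact_unit ?q_unit // mulrAC mulVr ?q_unit // mul1r.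
rewrite /gweight -mulrA E {1}/Wprod big_ord_recr /= -/(Wprod _ _ _).
have -> : q ^+ (n.+1 ^ 2)%N * x ^+ n.+1 =
  (q ^+ (n ^ 2)%N * x ^+ n) * (q ^+ (2 * n).+1 * x).
  have -> : (n.+1 ^ 2 = n ^ 2 + (2 * n).+1)%N by lia.
  by rewrite exprD [x ^+ _]exprSr mulrACA.
rewrite [(_ * (q ^+ (2 * n).+1 * x)) ^+ K]exprMn; ring.
Qed.

End Weights.

(** * The deformed multisum and its q-difference equations *)

Section GordonSeries.
Variables (R : comUnitRingType) (s : summation R) (q : R).
Hypothesis q_unit : forall n, (1 - q ^+ n.+1) \is a GRing.unit.
Hypothesis q_reg : GRing.lreg q.
Implicit Types (x v : R) (K i n : nat).

Local Notation gweight := (gweight q).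
Local Notation Wprod := (Wprod q).
Local Notation fsum := (fsum s).
Local Notation null := (null s).

(* The multisum over N_1 >= ... >= N_K with exponent part N_(i+1) + ... + N_K,
   unrolled from the innermost index n = N_K. *)
Fixpoint Aser K i x v : R :=
  if K is K'.+1 then
    fsum (fun n => gweight K' n x v * q ^+ (n * (K - i))%N *
                   Aser K' i (x * q ^+ (2 * n)%N) (v * q ^+ n))
  else 1.

(** At v = x this is x times [Gser K i (x * q)], so the right-hand sides below deform those of the
    recursion for F_i; the value 0 at i = 0 matches F_0 = 0. *)
Definition Tser K i x v : R :=
  if i is j.+1 then
    v * Aser K i (x * q) (v * q) + x * Aser K j (x * q) (v * q)
  else 0.

Lemma AserS K i x v : Aser K.+1 i x v =
  fsum (fun n => gweight K n x v * q ^+ (n * (K.+1 - i))%N *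
                   Aser K i (x * q ^+ (2 * n)%N) (v * q ^+ n)).
Proof. by []. Qed.

Lemma Aser_out K i x v : (K <= i)%N -> Aser K i x v = Aser K K x v.
Proof.
elim: K i x v => // K IHK i x v le_Ki; rewrite !AserS.
apply: eq_fsum => n; rewrite IHK 1?ltnW // [in RHS]IHK //.
by have -> : (K.+1 - i = K.+1 - K.+1)%N by lia.
Qed.

Lemma gweight_summable K x v : null x -> null v ->
  summable s (fun n => gweight K n x v).
Proof.
move=> x0 v0; have sW : summable s (fun n => Wprod n x v).
  apply: (summable_prod (a := fun j : nat => q ^+ j.+1 * (x * q ^+ j + v))) => j.
  by rewrite mulrC; apply/nullMr/nullD => //; apply: nullMr.
exact: (summableMr _ (summableMr _ sW)).
Qed.

(** The factor 1 - q^n kills the term n = 0 and cancels the last factor of (q)_n in the others,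
    which allows reindexing by n + 1. *)
Lemma gsum_shift K x v (h : nat -> R) : null x -> null v ->
  fsum (fun n => gweight K n x v * (1 - q ^+ n) * h n) =
  fsum (fun n => gweight K n x v *
    (q ^+ n.+1 * (x * q ^+ n + v) * (q ^+ (2 * n).+1 * x) ^+ K * h n.+1)).
Proof.
move=> x0 v0; rewrite fsum_recl; last first.
  by do 2!apply: summableMr; apply: gweight_summable.
rewrite expr0 subrr mulr0 mul0r add0r; apply: eq_fsum => n.
by rewrite gweightS //; ring.
Qed.

(** For i = 0 the linear exponent is the sum of all the indices, which is the joint degree of the
    summand in x and v. *)
Lemma Aser0 K x v : Aser K 0 x v = Aser K K (x * q) (v * q).
Proof.
elim: K x v => // K IHK x v; rewrite !AserS; apply: eq_fsum => n.
rewrite subn0 subnn muln0 expr0 mulr1 gweight_scale IHK [in RHS]Aser_out //.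
by congr (_ * Aser K K _ _); ring.
Qed.


Lemma Tser_scaled K i x v n : Tser K i (x * q ^+ (2 * n)%N) (v * q ^+ n) =
  q ^+ n * (if i is j.+1 then
    v * Aser K i (x * q * q ^+ (2 * n)%N) (v * q * q ^+ n)
    + x * q ^+ n * Aser K j (x * q * q ^+ (2 * n)%N) (v * q * q ^+ n) else 0).
Proof.
case: i => [|i] /=; first by rewrite mulr0.
have -> : x * q ^+ (2 * n)%N * q = x * q * q ^+ (2 * n)%N by ring.
have -> : v * q ^+ n * q = v * q * q ^+ n by ring.
move: (Aser K i.+1 _ _) (Aser K i _ _) => a b; rewrite mul2n -addnn exprD; ring.
Qed.

(** Both summands of [Tser] unroll over the same n. Their exponents differ by n, which is what the
    scaling x q^(2n), v q^n produces between the two coefficients. *)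
Lemma TserS K i x v : null x -> null v -> (i <= K.+1)%N ->
  Tser K.+1 i x v =
  fsum (fun n => gweight K n x v * (q ^+ (n * (2 * K + 1 - i))%N *
                 Tser K i (x * q ^+ (2 * n)%N) (v * q ^+ n))).
Proof.
move=> x0 v0; case: i => [_|i le_iK].
  rewrite -[LHS](mul0r (fsum (fun n => gweight K n x v))) fsumMl; last first.
    exact: gweight_summable.
  by apply: eq_fsum => n; rewrite mul0r !mulr0.
have sg := gweight_summable K (nullMr q x0) (nullMr q v0).
rewrite /Tser !AserS !fsumMl; do ?[by do 2!apply: summableMr].
rewrite fsumD; apply: eq_fsum => n; rewrite -/(Tser K i.+1 _ _) Tser_scaled.
rewrite gweight_scale.
have -> : q ^+ (n * (K.+1 - i))%N = q ^+ (n * (K.+1 - i.+1))%N * q ^+ n.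
  by rewrite -exprD; apply: qexpE; nia.
move: (Aser K _ _ _) (Aser K _ _ _) => a b.
have E : q ^+ (n * (2 * K + 1 - i.+1))%N * q ^+ n =
    q ^+ (n * K.+1)%N * q ^+ (n * (K.+1 - i.+1))%N.
  by rewrite -!exprD; apply: qexpE; nia.
by rewrite [X in _ = _ * X]mulrA E; ring.
Qed.

Definition Arec K := forall i x v, null x -> null v -> (i <= K)%N ->
  Aser K i.+1 x v - Aser K i x v = q * (x * q) ^+ i * Tser K (K - i) x v.

Definition Qrec K := forall i x v, null x -> null v -> (i <= K)%N ->
  (x + v) * Aser K i (x * q) v = Tser K i.+1 x v + v * q * Tser K i x v.

(** [Arec] turns both differences of [Aser] into values of [Tser] at (x q, v q), and [Qrec] at that
    point recombines them. For j = 0 the claim is [Qrec] at i = 0 together with [Aser0]. *)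
Lemma Tser_diff K j x v : Arec K -> Qrec K -> null x -> null v ->
  (j <= K)%N -> Tser K j.+1 x v - Tser K j x v =
  (x * q ^+ 2) ^+ j * (x + v) * Aser K (K - j) (x * q ^+ 2) (v * q).
Proof.
move=> RK QK x0 v0; have xq0 := nullMr q x0; have vq0 := nullMr q v0.
case: j => [_|j lt_jK].
  have := QK 0%N x v x0 v0 isT; have -> : Tser K 0 x v = 0 by [].
  by rewrite mulr0 addr0 subr0 => <-; rewrite expr0 mul1r subn0 Aser0 -mulrA -expr2.
have -> : Tser K j.+2 x v - Tser K j.+1 x v =
    v * (Aser K j.+2 (x * q) (v * q) - Aser K j.+1 (x * q) (v * q))
    + x * (Aser K j.+1 (x * q) (v * q) - Aser K j (x * q) (v * q)).
  by rewrite /Tser; ring.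
rewrite !RK // ?(ltnW lt_jK) //.
have := QK (K - j.+1)%N _ _ xq0 vq0 (leq_subr _ _).
rewrite -subSn // subSS.
have -> : x * q * q = x * q ^+ 2 by ring.
move: (Aser K _ _ _) (Tser K _ _ _) (Tser K _ _ _) => a t1 t2 QE.
have -> : (x * q ^+ 2) ^+ j.+1 * (x + v) * a
  = (x * q ^+ 2) ^+ j * (x * q) * ((x * q + v * q) * a).
  by rewrite exprS; ring.
by rewrite QE exprS; ring.
Qed.

Lemma Arec_step K : Arec K -> Qrec K -> Arec K.+1.
Proof.
move=> RK QK i x v x0 v0; rewrite leq_eqVlt => /predU1P[->|le_iK].
  by rewrite subnn mulr0 Aser_out // subrr.
have sg := gweight_summable K x0 v0.
rewrite (TserS x0 v0) ?leq_subr // fsumMl; last exact: (summableMr _ sg).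
rewrite !AserS; apply: (canLR (addrK _)); rewrite addrC.
have shift := gsum_shift K (fun n => q ^+ (n * (K - i))%N *
   Aser K i (x * q ^+ (2 * n)%N) (v * q ^+ n)) x0 v0.
(* With A_i for the inner [Aser K i], this splits q^(n(K-i)) A_(i+1) as q^(n(K+1-i)) A_i +
   q^(n(K-i)) (A_(i+1) - A_i) + (1 - q^n) q^(n(K-i)) A_i. The first sum is [Aser K.+1 i], the second
   is treated by [Arec], the third by [gsum_shift]. *)
transitivity (fsum (fun n => gweight K n x v * q ^+ (n * (K.+1 - i))%N *
    Aser K i (x * q ^+ (2 * n)%N) (v * q ^+ n)) +
  fsum (fun n => gweight K n x v * (q ^+ (n * (K - i))%N *
      (Aser K i.+1 (x * q ^+ (2 * n)%N) (v * q ^+ n)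
       - Aser K i (x * q ^+ (2 * n)%N) (v * q ^+ n)))) +
  fsum (fun n => gweight K n x v * (1 - q ^+ n) * (q ^+ (n * (K - i))%N *
   Aser K i (x * q ^+ (2 * n)%N) (v * q ^+ n)))).
  rewrite !fsumD; apply: eq_fsum => n; rewrite subSS subSn // mulnS exprD.
  move: (Aser K _ _ _) (Aser K _ _ _) => a b; ring.
rewrite shift -!addrA; congr (_ + _); rewrite fsumD; apply: eq_fsum => n.
have xn0 := nullMr (q ^+ (2 * n)%N) x0; have vn0 := nullMr (q ^+ n) v0.
rewrite RK // -mulrDr [RHS]mulrCA; congr (_ * _).
(* The shifted term contains the right-hand side of this difference, and adding the T_(K-i) coming
   from [Arec] yields T_(K+1-i). *)
have := Tser_diff (j := K - i) RK QK xn0 vn0 (leq_subr _ _).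
rewrite subKn // -subSn // => /(canRL (subrK _)) ->.
have -> : x * q ^+ (2 * n.+1)%N = x * q ^+ (2 * n)%N * q ^+ 2.
  by rewrite -mulrA -exprD; congr (_ * _ ^+ _); lia.
have -> : v * q ^+ n.+1 = v * q ^+ n * q by rewrite exprSr mulrA.
move: (Tser K _ _ _) (Aser K _ _ _) => t a.
have [j ->] : exists j, K = (i + j)%N by exists (K - i)%N; lia.
rewrite addKn.
have -> : (2 * (i + j) + 1 - ((i + j).+1 - i) = i + i + j)%N by lia.
have -> : q ^+ (n * (i + i + j))%N = (q ^+ n) ^+ i * (q ^+ n) ^+ i * (q ^+ n) ^+ j.
  by rewrite exprM !exprD.
have -> : q ^+ (n.+1 * j)%N = q ^+ j * (q ^+ n) ^+ j by rewrite mulSn exprD exprM.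
rewrite (exprM _ n j) !exprS mul2n -addnn !exprD expr0.
move: (q ^+ n) => z; rewrite !exprMn expr1n; ring.
Qed.

Lemma Qrec_step K : Arec K -> Qrec K -> Qrec K.+1.
Proof.
move=> RK QK i x v x0 v0 le_iK; have sg := gweight_summable K x0 v0.
have sgq := gweight_summable K (nullMr q x0) v0.
rewrite AserS fsumMl; last exact: (summableMr _ (summableMr _ sgq)).
move: le_iK; rewrite leq_eqVlt => /predU1P[->|le_iK]; last first.
  rewrite !(TserS x0 v0) ?(ltnW le_iK) // [v * q * _]fsumMl; last first.
    exact: (summableMr _ sg).
  rewrite fsumD; apply: eq_fsum => n.
  rewrite [LHS]mulrA [X in X * _ = _]mulrA gweight_recl.
  have xn0 := nullMr (q ^+ (2 * n)%N) x0; have vn0 := nullMr (q ^+ n) v0.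
  have := QK i _ _ xn0 vn0 le_iK.
  rewrite [x * q ^+ _ * q]mulrAC.
  move: (Aser K _ _ _) (Tser K _ _ _) (Tser K _ _ _) => a t1 t2.
  have [j ->] : exists j, K = (i + j)%N by exists (K - i)%N; lia.
  have -> : (n * (2 * (i + j) + 1 - i.+1) = n * (i + j) + n * j)%N by nia.
  have -> : (n * (2 * (i + j) + 1 - i) = n * (i + j) + n * j + n)%N by nia.
  have -> : (n * ((i + j).+1 - i) = n * j + n)%N by nia.
  rewrite !(exprD _ _ n) !(exprD _ _ (n * j)) mul2n -addnn !exprD => QE.
  move: (gweight _ _ _ _) (q ^+ (n * (i + j))) (q ^+ (n * j)) => g z1 z2.
  have -> : g * (x * q ^+ n + v) * z1 * (z2 * q ^+ n) * a =
    g * z1 * z2 * ((x * (q ^+ n * q ^+ n) + v * q ^+ n) * a) by ring.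
  by rewrite QE; ring.
(* In the boundary case i = K + 1, [TserS] does not cover T_(K+2), but [Aser_out] makes it a single
   multiple of [Aser]. *)
rewrite subnn (TserS (i := K.+1)) //.
have -> : Tser K.+1 K.+2 x v = (x + v) * Aser K.+1 K.+1 (x * q) (v * q).
  by rewrite /Tser Aser_out //; ring.
have sgqq := gweight_summable K (nullMr q x0) (nullMr q v0).
rewrite AserS !fsumMl; do ?[exact: (summableMr _ sg)];
  last exact: (summableMr _ (summableMr _ sgqq)).
rewrite fsumD subnn.
pose B n := Aser K K (x * q * q ^+ (2 * n)%N) (v * q * q ^+ n).
have shift := gsum_shift K (fun n => v * q ^+ (n * K)%N * B n) x0 v0.
(* The two sides do not agree term by term. The same sum is added to both and reindexed on the left
   only; after that the terms match. *)
apply: (addIr (fsum (fun n => gweight K n x v * (1 - q ^+ n) *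
   (v * q ^+ (n * K)%N * B n)))).
rewrite {1}shift !fsumD; apply: eq_fsum => n.
have xn0 := nullMr (q ^+ (2 * n)%N) x0; have vn0 := nullMr (q ^+ n) v0.
set C := Aser K K.+1 (x * q * q ^+ (2 * n)%N) (v * q ^+ n).
have TE : Tser K K.+1 (x * q ^+ (2 * n)%N) (v * q ^+ n) =
    q ^+ n * (x * q ^+ n + v) * B n.
  by rewrite Tser_scaled Aser_out // -/(B n); ring.
have core : (x * q ^+ n + v) * C + v * q * q ^+ n * (x * q ^+ n + v) *
    (x * q ^+ (2 * n.+1)%N) ^+ K * B n.+1 =
    (x * q ^+ n + v) * (1 + v * q * q ^+ n) * B n.
  (* At (x q^(2n), v q^n) the factor x + v becomes q^n (x q^n + v), so the available equations give
     the claim multiplied by q^n. *)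
  have /(_ _ _) reg := @lregX _ _ n q_reg; apply: reg.
  have := QK K _ _ xn0 vn0 (leqnn K); have := Tser_diff RK QK xn0 vn0 (leqnn K).
  rewrite subnn Aser0 TE => /(canRL (subKr _)) ->.
  have -> : x * q ^+ (2 * n)%N * q ^+ 2 * q = x * q * q ^+ (2 * n.+1)%N.
    by rewrite mulnS exprD; ring.
  have -> : v * q ^+ n * q * q = v * q * q ^+ n.+1 by rewrite exprS; ring.
  rewrite -/(B n.+1) [x * q ^+ _ * q]mulrAC -(Aser_out _ _ (leqnSn K)) -/C.
  have -> : x * q ^+ (2 * n)%N * q ^+ 2 = x * q ^+ (2 * n.+1)%N.
    by rewrite -mulrA -exprD addnC mulnS.
  have -> : x * q ^+ (2 * n)%N + v * q ^+ n = q ^+ n * (x * q ^+ n + v).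
    by rewrite mul2n -addnn exprD; ring.
  move: (B n) (B n.+1) ((_ * _) ^+ K) => b b' X E.
  rewrite mulrDr [_ * (_ * C)]mulrA E; ring.
rewrite muln0 expr0 mulr1 TE.
transitivity (gweight K n x v * q ^+ (n * K)%N * ((x * q ^+ n + v) * C +
  v * q * q ^+ n * (x * q ^+ n + v) * (x * q ^+ (2 * n.+1)%N) ^+ K * B n.+1)).
  rewrite [(x + v) * _]mulrA gweight_recl.
  have -> : q ^+ (n.+1 * K)%N = q ^+ (n * K)%N * q ^+ K by rewrite mulSnr exprD.
  have -> : (x * q ^+ (2 * n.+1)%N) ^+ K = (q ^+ (2 * n).+1 * x) ^+ K * q ^+ K.
    by rewrite -exprMn mulnS !exprS; congr (_ ^+ _); ring.
  rewrite exprS; ring.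
rewrite core gweight_scale Aser_out // -/(B n).
have -> : (2 * K + 1 - K.+1 = K)%N by lia.
rewrite mulnS exprD; ring.
Qed.

Lemma Arec_Qrec K : Arec K /\ Qrec K.
Proof.
elim: K => [|K [RK QK]]; last by split; [apply: Arec_step|apply: Qrec_step].
split=> i x v _ _; rewrite leqn0 => /eqP->; rewrite /= ?subnn ?mulr0 ?subrr //.
by rewrite !mulr1 addr0 addrC.
Qed.

(* Twice the multisum for k = K + 1: at v = x the two terms are the contributions
   of 1 and q^(N_i) in the factor 1 + q^(N_i). *)
Definition Gser K i x : R := if i is j.+1 then Aser K i x x + Aser K j x x else 0.

(** For i > 0 the difference is (A_(i+1) - A_i) + (A_i - A_(i-1)) at v = x, and [Arec] applies to
    each bracket. For i = 0 the second one is replaced by A_0, rewritten by [Aser0]. *)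
Lemma Gser_rec K i x : null x -> (i <= K)%N -> Gser K i.+1 x - Gser K i x =
  (x * q) ^+ i * Gser K (K.+1 - i) (x * q) + (x * q) ^+ i.+1 * Gser K (K - i) (x * q).
Proof.
move=> x0 le_iK; have [RK _] := Arec_Qrec K.
have TG j : Tser K j x x = x * Gser K j (x * q).
  by case: j => [|j] /=; rewrite ?mulr0 // mulrDr.
have lastE : q * (x * q) ^+ i * Tser K (K - i) x x =
    (x * q) ^+ i.+1 * Gser K (K - i) (x * q) by rewrite TG exprS; ring.
rewrite -lastE -RK //; case: i le_iK {lastE} => [_|i le_iK] /=.
  by rewrite subn0 subr0 expr0 mul1r [Aser K K.+1 _ _]Aser_out // -Aser0; ring.
have -> : (x * q) ^+ i.+1 * Gser K (K.+1 - i.+1) (x * q) =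
    q * (x * q) ^+ i * Tser K (K - i) x x by rewrite TG exprS subSS; ring.
by rewrite -RK ?(ltnW le_iK) //; ring.
Qed.

End GordonSeries.

(** * Infinite sums of formal power series *)

Section FormalSum.
Variable R : comNzRingType.
Implicit Types (g h : nat -> {fps R}) (c f : {fps R}).

(** The n-th term has order at least n, so the coefficient of degree m involves only n <= m, which
    is where [fps_sum] truncates. *)
Definition fps_summable g := forall n m, (m < n)%N -> g n m = 0.

Definition fps_sum g : {fps R} := FPS (fun m => (\sum_(n < m.+1) g n m)).

Lemma fps_sum_coef g m M : fps_summable g -> (m < M)%N ->
  fps_sum g m = \sum_(n < M) g n m.
Proof.
move=> sg; elim: M => // M IHM; rewrite ltnS leq_eqVlt => /predU1P[->//|lt_mM].
by rewrite big_ord_recr /= -IHM // sg // addr0.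
Qed.

Definition fps_null f := f 0%N = 0.

Fact fps_nullD (f h : {fps R}) : fps_null f -> fps_null h -> fps_null (f + h).
Proof. by rewrite /fps_null fps_coefD => -> ->; rewrite addr0. Qed.

Fact fps_nullMr (f h : {fps R}) : fps_null f -> fps_null (f * h).
Proof. by rewrite /fps_null fps_coef0M => ->; rewrite mul0r. Qed.

Fact fps_summable_prod (a : nat -> {fps R}) : (forall j, fps_null (a j)) ->
  fps_summable (fun n => \prod_(j < n) a j).
Proof.
move=> a0; elim=> // n IHn m; rewrite ltnS => le_mn.
rewrite big_ord_recr /= fps_coefM big1 // => i _.
have [lt_in|le_ni] := ltnP i n; first by rewrite IHn ?mul0r.
have -> : (m - i = 0)%N by have := ltn_ord i; lia.
by rewrite a0 mulr0.
Qed.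

Fact fps_summableMr g h : fps_summable g -> fps_summable (fun n => g n * h n).
Proof.
move=> sg n m lt_mn; rewrite fps_coefM big1 // => i _.
by rewrite sg ?mul0r // (leq_ltn_trans _ lt_mn) // -ltnS.
Qed.

Fact eq_fps_sum g h : g =1 h -> fps_sum g = fps_sum h.
Proof. by move=> gh; apply/fpsP => m; apply: eq_bigr => n _; rewrite gh. Qed.

Fact fps_sumD g h : fps_sum g + fps_sum h = fps_sum (fun n => g n + h n).
Proof. by apply/fpsP => m; rewrite fps_coefD -big_split. Qed.

Fact fps_sumMl c g :
  fps_summable g -> c * fps_sum g = fps_sum (fun n => c * g n).
Proof.
move=> sg; apply/fpsP => m; rewrite fps_coefM fpsE.
under [RHS]eq_bigr do rewrite fps_coefM.
rewrite exchange_big /=; apply: eq_bigr => i _.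
by rewrite (@fps_sum_coef _ _ m.+1) ?ltnS ?leq_subr // mulr_sumr.
Qed.

Fact fps_sum_recl g :
  fps_summable g -> fps_sum g = g 0%N + fps_sum (fun n => g n.+1).
Proof.
move=> sg; apply/fpsP => m.
by rewrite (@fps_sum_coef _ _ m.+2) // big_ord_recl fps_coefD.
Qed.

Definition fps_summation : summation {fps R} :=
  Summation fps_nullD fps_nullMr fps_summable_prod fps_summableMr
    eq_fps_sum fps_sumD fps_sumMl fps_sum_recl.

Fact fpsC_is_additive : additive (@fpsC R).
Proof. by move=> a b; apply/fpsP => -[|n]; rewrite fps_coefB //= subr0. Qed.

Fact fpsC_is_monoid_morphism : monoid_morphism (@fpsC R).
Proof.
split; first by apply/fpsP => -[|n].
by move=> a b; apply/fpsP => -[|n]; rewrite fps_coefCM //= fpsE mulr0.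
Qed.

HB.instance Definition _ :=
  GRing.isZmodMorphism.Build R {fps R} (@fpsC R) fpsC_is_additive.
HB.instance Definition _ :=
  GRing.isMonoidMorphism.Build R {fps R} (@fpsC R) fpsC_is_monoid_morphism.

End FormalSum.

(** * Summands of the unrolled multisum and their index lists *)

Section MultisumTerm.
Variables (R : comUnitRingType) (q : R).
Implicit Types (x v : R) (N M : seq nat) (i n : nat).

(** The default 0 of [nth] past the end makes the last factor that of the smallest index alone. *)
Definition mdenom N : R :=
  \prod_(r < size N) qfact q (nth 0 N r - nth 0 N r.+1)%N.

Definition mterm i x v N : R :=
  Wprod q (head 0%N N) x v * x ^+ sumn (behead N) *
  q ^+ (sumn [seq (n ^ 2)%N | n <- behead N] + sumn (drop i N))%N / mdenom N.

Lemma sumn_map_addn n M : sumn [seq (n + m)%N | m <- M] = (n * size M + sumn M)%N.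
Proof. by elim: M => /= [|m M ->]; nia. Qed.

Lemma sumn_sqr_map_addn n M : sumn [seq (m ^ 2)%N | m <- [seq (n + m)%N | m <- M]] =
  (n ^ 2 * size M + 2 * n * sumn M + sumn [seq (m ^ 2)%N | m <- M])%N.
Proof. by elim: M => /= [|m M ->]; nia. Qed.

Lemma sumn_drop_step i n M : sumn (drop i (rcons [seq (n + m)%N | m <- M] n)) =
  (n * ((size M).+1 - i) + sumn (drop i M))%N.
Proof.
elim: M i => [|m M IHM] [|i] //=; rewrite ?drop0 ?IHM //.
- by lia.
- by rewrite subSS sub0n muln0.
- by rewrite sumn_rcons sumn_map_addn; nia.
Qed.

Lemma mdenom_step n M : mdenom (rcons [seq (n + m)%N | m <- M] n) =
  mdenom M * qfact q n.
Proof.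
rewrite /mdenom size_rcons size_map big_ord_recr /=.
rewrite !nth_rcons size_map ltnn eqxx ltnNge leqnSn /= gtn_eqF // subn0.
congr (_ * _); apply: eq_bigr => r _; congr (qfact _ _).
rewrite !nth_rcons size_map ltn_ord (nth_map 0%N) //.
have := ltn_ord r; rewrite leq_eqVlt => /predU1P[rE|lt_r].
  by rewrite rE ltnn eqxx (nth_default _ (leqnn (size M))) subn0 addKn.
by rewrite lt_r (nth_map 0%N) // subnDl.
Qed.

Hypothesis q_unit : forall n, (1 - q ^+ n.+1) \is a GRing.unit.

Lemma mdenom_unit N : mdenom N \is a GRing.unit.
Proof.
rewrite /mdenom; elim/big_rec: _ => [|j f _ uf]; rewrite ?unitr1 //.
by rewrite unitrM qfact_unit.
Qed.

(** With N_r = n + M_r, the cross terms 2 n M_r of the squares account for x q^(2n), and [Wprod_add]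
    handles the outermost index. *)
Lemma mterm_step i n x v M : mterm i x v (rcons [seq (n + m)%N | m <- M] n) =
  gweight q (size M) n x v * q ^+ (n * ((size M).+1 - i))%N *
  mterm i (x * q ^+ (2 * n)%N) (v * q ^+ n) M.
Proof.
rewrite /mterm sumn_drop_step mdenom_step /gweight.
rewrite invrM ?qfact_unit ?mdenom_unit //.
case: M => [|m M] /=.
  by rewrite /Wprod /mdenom !big_ord0 !expr0 invr1 !addn0 add0n; ring.
rewrite Wprod_add sumn_rcons sumn_map_addn map_rcons sumn_rcons sumn_sqr_map_addn.
set S := sumn [seq (_ ^ 2)%N | _ <- _]; set D := sumn (drop _ _).
set e := (n * (_ - i))%N.
have -> : (n * size M + sumn M + n = n * (size M).+1 + sumn M)%N by lia.
have -> : (n ^ 2 * size M + 2 * n * sumn M + S + n ^ 2 + (e + D) =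
  n ^ 2 * (size M).+1 + e + (2 * n * sumn M) + (S + D))%N by lia.
rewrite (exprD q _ (S + D)) (exprD q _ (_ * sumn M)) (exprD q _ e) (exprM q (2 * n)).
rewrite (exprM q (n ^ 2)) exprD [x ^+ (n * _)]exprM !exprMn; ring.
Qed.

Lemma mterm_scale i x c N : mterm i (x * c) (x * c) N = c ^+ sumn N * mterm i x x N.
Proof.
rewrite /mterm Wprod_scale; have -> : sumn N = (head 0 N + sumn (behead N))%N.
  by case: N.
by rewrite (exprD c) exprMn; ring.
Qed.

End MultisumTerm.

Lemma mterm_morph (R S : comUnitRingType) (f : {rmorphism R -> S}) q i x v N :
  (forall n, (1 - q ^+ n.+1) \is a GRing.unit) ->
  f (mterm q i x v N) = mterm (f q) i (f x) (f v) N.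
Proof.
move=> uq; rewrite /mterm rmorphM rmorphV ?mdenom_unit // !rmorphM !rmorphXn.
congr (_ * _ * _ / _); rewrite /Wprod /mdenom rmorph_prod; apply: eq_bigr => r _.
  by rewrite rmorphM rmorphD rmorphM !rmorphXn.
rewrite /qfact rmorph_prod; apply: eq_bigr => j _.
by rewrite rmorphB rmorph1 rmorphXn.
Qed.

(** The smallest entry n is split off and subtracted from the others, in parallel with the unrolling
    of [Aser]; the bound [B] on the entries keeps the list finite. *)
Fixpoint multi_index (K B : nat) : seq (seq nat) :=
  if K is K'.+1 then
    [seq rcons [seq (n + m)%N | m <- M] n
      | n <- iota 0 B.+1, M <- multi_index K' (B - n)%N]
  else [:: [::]].

Lemma multi_indexS K B : multi_index K.+1 B =
  [seq rcons [seq (n + m)%N | m <- M] n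
    | n <- iota 0 B.+1, M <- multi_index K (B - n)%N].
Proof. by []. Qed.

Lemma sorted_geq_rcons s n :
  sorted geq (rcons s n) = sorted geq s && all (leq n) s.
Proof.
have geq_rev t : sorted geq t = sorted leq (rev t) by rewrite rev_sorted.
rewrite !geq_rev rev_rcons /= path_sortedE ?all_rev 1?andbC //.
exact: leq_trans.
Qed.

Lemma mem_multi_index K B N : (N \in multi_index K B) =
  [&& size N == K, sorted geq N & all (leq^~ B) N].
Proof.
elim: K B N => [|K IHK] B N; first by rewrite inE; case: N.
rewrite multi_indexS.
apply/allpairsPdep/idP => [[n [M []]]|/and3P[]].
  rewrite mem_iota IHK ltnS => /= le_nB /and3P[/eqP sM sortM allM] ->.
  rewrite size_rcons size_map sM eqxx sorted_geq_rcons all_rcons le_nB /=.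
  rewrite sorted_map !all_map -andbA; apply/and3P; split.
  - by rewrite (eq_sorted (e' := geq)) // => a b /=; rewrite leq_add2l.
  - by apply/allP => m _ /=; rewrite leq_addr.
  - by apply/allP => m /(allP allM) /=; lia.
case/lastP: N => // N n; rewrite size_rcons eqSS sorted_geq_rcons all_rcons.
move=> sN /andP[sortN ltN] /andP[le_nB allN].
have NE : [seq (n + m)%N | m <- [seq (m - n)%N | m <- N]] = N.
  rewrite -map_comp -[RHS]map_id; apply/eq_in_map => m /(allP ltN) /=.
  exact: subnKC.
exists n, [seq (m - n)%N | m <- N]; rewrite NE mem_iota IHK size_map sN; split=> //.
rewrite all_map /=; apply/andP; split; last first.
  by apply/allP => m /(allP allN) /=; lia.
move: sortN; rewrite -{1}NE sorted_map; apply: sub_sorted => a b /=.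
by rewrite leq_add2l.
Qed.

Lemma uniq_multi_index K B : uniq (multi_index K B).
Proof.
elim: K B => // K IHK B; rewrite multi_indexS.
apply: allpairs_uniq_dep; rewrite ?iota_uniq // => -[n M] [n' M'].
move=> /allpairsPdep[a [b [_ _ [-> ->]]]] /allpairsPdep[c [d [_ _ [-> ->]]]].
move=> /= /rcons_inj[]; move=> + E; rewrite E => /(inj_map (@addnI _)) ->.
by [].
Qed.

Section Unroll.
Variables (R : comUnitRingType) (q : {fps R}).
Hypothesis q_unit : forall n, (1 - q ^+ n.+1) \is a GRing.unit.

Local Notation Aser := (Aser (fps_summation R) q).

Lemma Aser_multi_index K B i (x v : {fps R}) m : x 0%N = 0 -> v 0%N = 0 -> (m <= B)%N ->
  Aser K i x v m = \sum_(N <- multi_index K B) mterm q i x v N m.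
Proof.
elim: K B x v m => [|K IHK] B x v m x0 v0 le_mB.
  rewrite /= big_seq1 /mterm /Wprod /mdenom !big_ord0.
  by rewrite !expr0 !mul1r invr1.
have sg := @gweight_summable _ (fps_summation R) q K x v x0 v0.
rewrite AserS (@fps_sum_coef _ _ _ B.+1) //; last first.
  by do 2!apply: fps_summableMr; exact: sg.
rewrite multi_indexS big_allpairs_dep -[iota 0 B.+1]/(index_iota 0 B.+1) big_mkord.
apply: eq_bigr => [[n /= le_nB]] _.
have sizeM M : M \in multi_index K (B - n)%N -> size M = K.
  by rewrite mem_multi_index => /and3P[/eqP].
rewrite fps_coefM.
transitivity (\sum_(j < m.+1) \sum_(M <- multi_index K (B - n)%N)
   (gweight q K n x v * q ^+ (n * (K.+1 - i))%N) j *
   mterm q i (x * q ^+ (2 * n)%N) (v * q ^+ n) M (m - j)%N).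
  (* The weight has order at least n, so only j >= n matters, and then m - j <= B - n as the
     induction requires. *)
  apply: eq_bigr => j _; rewrite -mulr_sumr; have [lt_jn|le_nj] := ltnP j n.
    by rewrite (fps_summableMr (fun n => q ^+ (n * (K.+1 - i))%N) sg lt_jn) !mul0r.
  congr (_ * _); apply: IHK; rewrite ?fps_coef0M ?x0 ?v0 ?mul0r //.
  by lia.
rewrite exchange_big; apply: eq_big_seq => M /sizeM sM.
by rewrite mterm_step // sM fps_coefM.
Qed.

End Unroll.

(** * Specialisation to series in x and q *)

Section BivariateSeries.

Local Notation q := (@fpsX rat).
Local Notation Q := (fpsC q).
Local Notation x := (@fpsX {fps rat}).

Lemma fpsX_unit n : (1 - q ^+ n.+1) \is a GRing.unit.
Proof.
by rewrite fps_unitE fps_coefB fps_coef1 fps_coefXn subr0 unitr1.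
Qed.

Lemma fpsCX_unit n : (1 - Q ^+ n.+1) \is a GRing.unit.
Proof.
have -> : 1 - Q ^+ n.+1 = fpsC (1 - q ^+ n.+1) by rewrite rmorphB rmorph1 rmorphXn.
by rewrite rmorph_unit ?fpsX_unit.
Qed.

Lemma fpsCX_lreg : GRing.lreg Q.
Proof.
move=> f g /fpsP fg; apply/fpsP => m; apply/fpsP => n.
have := fg m; rewrite !fps_coefCM => /fpsP/(_ n.+1).
by rewrite !fps_coefXM.
Qed.

(** By homogeneity ([mterm_scale]) the summand is a power of x times its value at x = v = 1, a
    series in q alone. *)
Lemma mterm_coef i N m :
  mterm Q i x x N m = if m == sumn N then mterm q i 1 1 N else 0.
Proof.
rewrite -[x in mterm _ _ x _ _]mul1r -[x in mterm _ _ _ x _]mul1r mterm_scale.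
have -> : mterm Q i 1 1 N = fpsC (mterm q i 1 1 N).
  by rewrite (mterm_morph _ _ _ _ _ fpsX_unit) rmorph1.
by rewrite mulrC fps_coefCM fps_coefXn; case: eqP; rewrite ?mulr1 ?mulr0.
Qed.

Lemma mterm_coef_scaled i N m :
  mterm Q i (x * Q) (x * Q) N m = q ^+ m * mterm Q i x x N m.
Proof.
rewrite mterm_scale -rmorphXn fps_coefCM mterm_coef.
by case: eqP => [->|]; rewrite ?mulr0.
Qed.

Local Notation Aser := (Aser (fps_summation {fps rat}) Q).
Local Notation Gser := (Gser (fps_summation {fps rat}) Q).

Lemma fpsX_null : fps_null x. Proof. by []. Qed.

Lemma Gser_multi_index K i m : Gser K i.+1 x m =
  \sum_(N <- multi_index K m) (mterm Q i.+1 x x N m + mterm Q i x x N m).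
Proof.
by rewrite /= fps_coefD !(@Aser_multi_index _ _ fpsCX_unit _ m) // -big_split.
Qed.

Lemma Gser_scaled K i m : Gser K i (x * Q) m = q ^+ m * Gser K i x m.
Proof.
case: i => [|i]; first by rewrite /= fps_coef0 mulr0.
have xQ0 : (x * Q) 0%N = 0 by rewrite fps_coef0M mul0r.
rewrite Gser_multi_index /= fps_coefD.
rewrite !(@Aser_multi_index _ _ fpsCX_unit _ m) // -big_split mulr_sumr.
by apply: eq_bigr => N _; rewrite mulrDr; congr (_ + _); apply: mterm_coef_scaled.
Qed.

Lemma Gser_coef0 K i : Gser K i.+1 x 0%N = 1 + 1.
Proof.
rewrite /= fps_coefD.
suff A0 j (u v : {fps {fps rat}}) : Aser K j u v 0%N = 1 by rewrite !A0.
elim: K u v => // K IHK u v.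
rewrite AserS fpsE big_ord1 !fps_coef0M IHK mulr1 mul0n expr0 mulr1.
by rewrite /gweight /Wprod /qfact big_ord0 big_geq // !expr0 mulr1 expr1n invr1 !mulr1.
Qed.

Lemma Gser_shift_coef K i j m n : ((x * Q) ^+ j * Gser K i (x * Q)) m n =
  if (j <= m)%N && (m <= n)%N then Gser K i x (m - j)%N (n - m)%N else 0.
Proof.
rewrite exprMn -mulrA -rmorphXn fps_coefXnM ltnNge.
case: leqP => [le_jm|//] /=; rewrite fps_coefCM Gser_scaled mulrA -exprD subnKC //.
by rewrite fps_coefXnM ltnNge; case: leqP.
Qed.

Lemma Gser_coef_rec K i m n : (i <= K)%N ->
  Gser K i.+1 x m n = Gser K i x m n
    + (if (i <= m)%N && (m <= n)%N then Gser K (K.+1 - i) x (m - i)%N (n - m)%N else 0)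
    + (if (i < m)%N && (m <= n)%N then Gser K (K - i) x (m - i.+1)%N (n - m)%N else 0).
Proof.
move=> le_iK.
have := @Gser_rec _ (fps_summation {fps rat}) Q fpsCX_unit fpsCX_lreg K i x
  fpsX_null le_iK.
move/(canRL (subrK _)) => ->; rewrite fps_coefD [X in X + _]fps_coefD.
by rewrite 2!Gser_shift_coef addrC addrA.
Qed.

Lemma sumn_drop_nth j (s : seq nat) (f : nat -> nat) K : size s = K ->
  (\sum_(j.+1 <= r < K.+1) f (nth 0 s r.-1))%N = sumn [seq f a | a <- drop j s].
Proof.
move=> <-; rewrite big_add1 /= sumnE big_map [RHS](big_nth 0%N) size_drop.
rewrite -{1}[j]add0n big_addn; apply: eq_bigr => r _.
by rewrite nth_drop addnC.
Qed.

(** The factor 1 + q^0 supplies the 2; for n = 0 the product is empty and the 2 cancels against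
    (-q)_(-1) = 1/2. *)
Lemma Wprod11 n :
  Wprod q n 1 1 = q ^+ ((n + 1) * n %/ 2)%N * (1 + 1) * qpoch_mq_pred n.
Proof.
have -> : Wprod q n 1 1 = q ^+ ((n + 1) * n %/ 2)%N * \prod_(j < n) (1 + q ^+ j).
  elim: n => [|n IHn]; first by rewrite /Wprod !big_ord0 muln0 div0n expr0 mulr1.
  rewrite /Wprod !big_ord_recr /= -/(Wprod _ _ _ _) IHn.
  have -> : ((n.+1 + 1) * n.+1 %/ 2 = (n + 1) * n %/ 2 + n.+1)%N.
    have -> : ((n.+1 + 1) * n.+1 = n.+1 * 2 + (n + 1) * n)%N by lia.
    by rewrite divnMDl // addnC.
  by rewrite exprD mul1r; ring.
rewrite -mulrA; congr (_ * _); case: n => [|n].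
  rewrite big_ord0 qpoch_mq_pred0; apply/fpsP => -[|n]; rewrite mulrC fps_coefCM //.
rewrite qpoch_mq_predS big_ord_recl expr0 big_add1 /= big_mkord.
by congr (_ * _).
Qed.

(** Passing from i to i - 1 adds N_i to the exponent, which produces 1 + q^(N_i). *)
Lemma mterm_multisum K i (N : K.+2.-1.-tuple nat) : (1 <= i)%N ->
  mterm q i 1 1 N + mterm q i.-1 1 1 N =
  (1 + 1) * (q ^+ multisum_exponent i N * qpoch_mq_pred (Nr N 1)
        * (1 + q ^+ Nr N i) / multisum_denom N).
Proof.
case: i => // i _; rewrite /mterm /=.
have sN : size N = K.+1 by rewrite size_tuple.
have dropE : sumn (drop i N) = (nth 0%N N i + sumn (drop i.+1 N))%N.
  have [lt_iN|le_Ni] := ltnP i (size N); first by rewrite (drop_nth 0%N).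
  by rewrite !drop_oversize ?nth_default // leqW.
have denomE : multisum_denom N = mdenom q N.
  rewrite /multisum_denom /mdenom big_add1 /= big_mkord sN big_ord_recr /=.
  rewrite /Nr /= [nth _ _ K.+1]nth_default ?sN // subn0.
  rewrite qpoch_q; congr (_ * _); apply: eq_bigr => r _.
  exact: qpoch_q.
have expE : multisum_exponent i.+1 N =
  ((head 0 N + 1) * head 0 N %/ 2 + sumn [seq (n ^ 2)%N | n <- behead N]
   + sumn (drop i.+1 N))%N.
  rewrite /multisum_exponent /Nr /= nth0 -drop1; congr (_ + _ + _)%N.
    by rewrite -(sumn_drop_nth 1 (fun a => a ^ 2)%N sN).
  by rewrite (sumn_drop_nth i.+1 id sN) map_id.
rewrite !expr1n Wprod11 denomE expE dropE /Nr /= nth0.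
rewrite !(exprD q).
move: (qpoch_mq_pred _) (mdenom _ _)^-1 (q ^+ _) (q ^+ _) (q ^+ _) (q ^+ _).
move=> a b c d e f; ring.
Qed.

Lemma multisum_term_coef k i (N : k.-1.-tuple nat) m n :
  multisum_term i N m n = if m == (\sum_(1 <= r < k) Nr N r)%N then
   (q ^+ multisum_exponent i N * qpoch_mq_pred (Nr N 1)
        * (1 + q ^+ Nr N i) / multisum_denom N) n else 0.
Proof.
rewrite /multisum_term fps_coefCM fps_coefXn.
by case: eqP => _; rewrite ?mulr1 // mulr0.
Qed.

Lemma Gser_multisum_coef K i m : Gser K i.+1 x m = \sum_(N <- multi_index K m)
  if m == sumn N then mterm q i.+1 1 1 N + mterm q i 1 1 N else 0.
Proof.
rewrite Gser_multi_index; apply: eq_bigr => N _.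
transitivity ((if m == sumn N then mterm q i.+1 1 1 N else 0) +
              (if m == sumn N then mterm q i 1 1 N else 0)).
  by congr (_ + _); apply: mterm_coef.
by case: (m == sumn N) => //; exact: addr0.
Qed.

Lemma leq_sumn_mem (s : seq nat) a : a \in s -> (a <= sumn s)%N.
Proof.
elim: s => //= b s IHs; rewrite inE => /predU1P[->|/IHs]; first exact: leq_addr.
by move=> /leq_trans -> //; apply: leq_addl.
Qed.

(** The coefficient of x^m involves only tuples of sum m, whose entries are at most m; hence the
    finite list [multi_index K.+1 m] contains the support. *)
Lemma Gser_multisum K i : (1 <= i)%N ->
  fps2_has_sum (multisum_index K.+2) (fun N => multisum_term i N)
    (FPS (fun m => fpsC 2^-1 * Gser K.+1 i x m)).
Proof.
move=> i_gt0 m n; pose r : seq (K.+2.-1.-tuple nat) := pmap insub (multi_index K.+1 m).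
have mem_r (N : K.+2.-1.-tuple nat) : (N \in r) = sorted geq N && all (leq^~ m) N.
  by rewrite mem_pmap_sub mem_multi_index size_tuple eqxx.
have sumE (N : K.+2.-1.-tuple nat) : (\sum_(1 <= r < K.+2) Nr N r = sumn N)%N.
  by rewrite (sumn_drop_nth 0 id (size_tuple N)) drop0 map_id.
have supp (N : K.+2.-1.-tuple nat) :
    multisum_index K.+2 N -> multisum_term i N m n != 0 -> N \in r.
  rewrite mem_r /multisum_index /= => ->; rewrite multisum_term_coef sumE /=.
  case: (m =P sumn N) => [-> _|_ /eqP//]; apply/allP => a; exact: leq_sumn_mem.
split; first by apply: (sub_finite_set _ (finite_seq r)) => N /= [/supp].
rewrite (fsbigE r); first last.
- by move=> N /supp rN /negP Nr; apply/eqP/contraT => /rN.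
- by move=> N /=; rewrite mem_r => /andP[].
- exact/pmap_sub_uniq/uniq_multi_index.
rewrite -[RHS]/((fpsC 2^-1 * Gser K.+1 i x m) n) fps_coefCM.
case: i i_gt0 {supp} => // i _; rewrite Gser_multisum_coef.
rewrite fps_coef_sum mulr_sumr.
have rE : multi_index K.+1 m = [seq val N | N <- r].
  rewrite /r pmap_filter; last exact: insubK.
  rewrite -[LHS]filter_predT; apply: eq_in_filter => N.
  by rewrite mem_multi_index isSome_insub => /and3P[].
rewrite rE big_map big_seq_cond [RHS]big_seq_cond; apply: eq_big => [N|N].
  rewrite andbT andbC; case: (boolP (N \in r)) => [|_]; rewrite ?andbF //.
  by rewrite mem_r => /andP[sN _]; rewrite mem_set.
move=> _; rewrite (multisum_term_coef i.+1 N m n) sumE.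
case: (m == sumn N); last by rewrite fps_coef0 mulr0.
have -> := mterm_multisum N (ltn0Sn i).
move: (_ / multisum_denom N) => c.
by rewrite mulrDl mul1r fps_coefD; move: (c n) => a; field.
Qed.

End BivariateSeries.

(** * Comparison of the two recursions *)

Lemma Gser_overparts K i m n : (i <= K.+2)%N ->
  Gser (fps_summation {fps rat}) (fpsC fpsX) K.+1 i fpsX m n =
  (1 + 1) * (size (overparts K.+2 i m n))%:R.
Proof.
(* For m > 0 the shifted terms have q-degree n - m < n, while the remaining term keeps n and lowers
   i; hence strong induction on n with an inner induction on i. *)
elim/ltn_ind: n i m => n IHn; elim=> [|i IHi] m le_iK.
  by rewrite mulr0 !fps_coef0.
case: m => [|m].
  by rewrite size_overparts0 // (Gser_coef0 K.+1 i) fps_coefD fps_coef1 mulrDl mul1r.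
rewrite (Gser_coef_rec _ _ (le_iK : i <= K.+1)%N) size_overparts_rec // !natrD !mulrDr.
rewrite IHi ?(ltnW le_iK) // subSS; congr (_ + _ + _).
  case: ifP => [/andP[_ lt_mn]|_]; last by rewrite mulr0.
  by rewrite IHn ?leq_subr //; lia.
case: ifP => [/andP[_ lt_mn]|_]; last by rewrite mulr0.
by rewrite IHn //; lia.
Qed.

Theorem theorem1p7 (k i : nat) (hk : (2 <= k)%N) (hi : (1 <= i <= k)%N) :
  fps2_has_sum (multisum_index k) (fun N => multisum_term i N)
    (overpart_D_gf k i).
Proof.
case: k hk hi => [|[|K]] // _ /andP[i_gt0 le_iK] m n.
have [fin sumE] := Gser_multisum K i_gt0 m n; split=> //; rewrite sumE.
rewrite -[LHS]/((fpsC 2^-1 * Gser _ (fpsC fpsX) K.+1 i fpsX m) n).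
rewrite -[RHS]/((overpart_D K.+2 i m n)%:R) fps_coefCM Gser_overparts // size_overparts.
by case: i i_gt0 {le_iK fin sumE} => // i _; rewrite mulrA mulVf ?mul1r.
Qed.
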